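(* Let $X$ be a real Banach space and let $\mathcal{C}$ be a compatible class of bounded subsets of $X$. The following are equivalent: (a) For every $\varepsilon>0$, $\beta\ge 0$, $M\ge 2$ and $0<\eta<\varepsilon$, there exists $K>0$ such that for every closed convex $C\in\mathcal{C}$ with $\operatorname{diam}(C)\le M$ and $d(0,C+\beta B(X))\ge\varepsilon$, there exist $z_0\in X$ and $0<r\le K$ such that $C+\beta B(X)\subseteq B[z_0,r]$ and $d(0,B[z_0,r])>\eta$. (b) For every $\varepsilon>0$, $M\ge 2$ and $0<\eta<\varepsilon$, there exists $K>0$ such that for every closed convex $C\in\mathcal{C}$ with $\operatorname{diam}(C)\le M$ and $d(0,C)\ge\varepsilon$, there exist $z_0\in X$ and $0<r\le K$ such that $C\subseteq B[z_0,r]$ and $d(0,B[z_0,r])>\eta$. (c) For every $\varepsilon>0$, $\beta\ge 0$ and $M\ge 2$, there exist $K>0$ and $0<\eta<\varepsilon$ such that for every closed convex $C\in\mathcal{C}$ with $\operatorname{diam}(C)\le M$ and $d(0,C+\beta B(X))\ge\varepsilon$, there exist $z_0\in X$ and $0<r\le K$ such that $C+\beta B(X)\subseteq B[z_0,r]$ and $d(0,B[z_0,r])>\eta$. (d) For every $\varepsilon>0$ there exists $0<\delta<1$ such that for every $C\in\mathcal{C}$ with $C\subseteq B(X)$ and every $f\in S(X^* )$, there is $x\in S(X)$ such that $S(B(X^* ),x,\delta)\subseteq B_C(f,\varepsilon)$. (e) For every $\varepsilon>0$ there exists $\delta>0$ such that for every $C\in\mathcal{C}$ with $C\subseteq B(X)$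 and every $f\in S(X^* )$, there is $x\in S(X)$ such that $D(S(X)\cap B(x,\delta))\subseteq B_C(f,\varepsilon)$. (f) For every $\varepsilon>0$ there exists $\delta>0$ such that for every $C\in\mathcal{C}$ with $C\subseteq B(X)$ and every $f\in S(X^* )$, there exists $x\in M_{\varepsilon,\delta,C}(X)$ such that $D(x)\subseteq B_C(f,\varepsilon)$.
   Context: $B(X)=\{x:\|x\|\le 1\}$, $S(X)=\{x:\|x\|=1\}$ (similarly for $X^*$); $B(x,r)$ is the open ball and $B[x,r]$ the closed ball ($r>0$). $d(x,C)=\inf\{\|x-z\|:z\in C\}$. Compatible class: a class $\mathcal{C}$ of bounded subsets of $X$ such that (I) $C\in\mathcal{C}$, $\alpha\in\mathbb{R}$, $x\in X$ imply $\alpha C+x\in\mathcal{C}$ and $C\cup\{x\}\in\mathcal{C}$; (II) $C\in\mathcal{C}$ implies the closed absolutely convex hull of $C$ is in $\mathcal{C}$; (III) $C\in\mathcal{C}$ and $A\subseteq C$ imply $A\in\mathcal{C}$; (IV) $C_1,C_2\in\mathcal{C}$ implies $C_1\cup C_2\in\mathcal{C}$. For bounded $A\subseteq X$ and $f\in X^*$, $\|f\|_A=\sup\{|f(x)|:x\in A\}$, and $B_A(f,\varepsilon)=\{g\in X^*:\|f-g\|_A<\varepsilon\}$. For $x\in S(X)$ and $0<\delta<1$, $S(B(X^* ),x,\delta)=\{f\in B(X^* ): f(x)>1-\delta\}$ (a w*-slice). For $x\in S(X)$, $D(x)=\{f\in S(X^* ):f(x)=1\}$; for $A\subseteq S(X)$,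 $D(A)=\bigcup_{x\in A}D(x)$. For $\varepsilon,\delta>0$, $x\in S(X)$, $C\in\mathcal{C}$, let $$d_1(C,x,\delta)=\sup_{0<\lambda<\delta,\ y\in C}\frac{\|x+\lambda y\|+\|x-\lambda y\|-2}{\lambda},$$ and $M_{\varepsilon,\delta,C}(X)=\{x\in S(X): d_1(C,x,\delta)<\varepsilon\}$. *)

(* Defs.v *)
From HB Require Import structures.
From mathcomp Require Export all_boot all_order all_algebra.
From mathcomp Require Export all_classical all_reals all_analysis.
Export Order.TTheory GRing.Theory Num.Theory numFieldNormedType.Exports.

Set Implicit Arguments.
Unset Strict Implicit.
Unset Printing Implicit Defensive.

#[global] Open Scope classical_set_scope.
#[global] Open Scope ring_scope.

Section NormedSpace.
Context {R : realType} {X : normedModType R}.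
Implicit Types (A C : set X) (x z : X) (e d r : R).

Definition unit_ball : set X := [set x | `|x| <= 1].
Definition unit_sphere : set X := [set x | `|x| = 1].

(* [B[z, r]] *)
Definition cball z r : set X := closed_ball_ (fun x => `|x|) z r.

(* [C + e B(X)] *)
Definition enlarge C e : set X := [set y + e *: u | y in C & u in unit_ball].

(* The real infimum of the empty set is 0, so a hypothesis [0 < e <= dist x C]
   forces C to be nonempty. *)
Definition dist x C : R := inf [set `|x - z| | z in C].

Definition diam C : R := sup [set `|x - y| | x in C & y in C].

Definition balanced A :=
  forall (a : R) x, `|a| <= 1 -> A x -> A (a *: x).

Definition absolutely_convex A := convex_set A /\ balanced A.

Definition closed_absconvex_hull A : set X :=
  smallest [set B : set X | closed B /\ absolutely_convex B] A.

Record compatible_class (F : set (set X)) : Prop := CompatibleClass {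
  compatible_bounded : forall C, F C -> bounded_set C ;
  compatible_affine : forall C (a : R) x, F C -> F [set a *: y + x | y in C] ;
  compatible_setU1 : forall C x, F C -> F (C `|` [set x]) ;
  compatible_hull : forall C, F C -> F (closed_absconvex_hull C) ;
  compatible_subset : forall A C, F C -> A `<=` C -> F A ;
  compatible_setU : forall C1 C2, F C1 -> F C2 -> F (C1 `|` C2)
}.

(* [||f||_A]; a finite supremum when A is bounded and f is a continuous linear
   functional, and 0 when A is empty. *)
Definition norm_on A (f : X -> R) : R := sup [set `|f x| | x in A].

(* sup of (|x + l y| + |x - l y| - 2) / l over 0 < l < d and y in C; the
   quotients are nonnegative when |x| = 1, and the value is 0 when C is empty. *)
Definition d1 C x d : R :=
  sup [set (`|x + l *: y| + `|x - l *: y| - 2) / l |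
       l in [set l : R | 0 < l < d] & y in C].

Definition M_set e d C : set X := [set x | unit_sphere x /\ d1 C x d < e].

End NormedSpace.

Arguments unit_ball {R} X.
Arguments unit_sphere {R} X.

(* The topological dual [X^*]. *)
Record dual (R : realType) (X : normedModType R) := Dual {
  dual_val :> {linear X -> R^o} ;
  dual_continuous : continuous dual_val
}.

Section Dual.
Context {R : realType} {X : normedModType R}.
Implicit Types (A C : set X) (x : X) (f g : dual X) (e d : R).

Definition dual_norm f : R := norm_on (unit_ball X) f.

Definition dual_ball : set (dual X) := [set f : dual X | dual_norm f <= 1].
Definition dual_sphere : set (dual X) := [set f : dual X | dual_norm f = 1].

(* [B_A(f, e)] *)
Definition seminorm_ball A f e : set (dual X) :=
  [set g : dual X | norm_on A (fun x => f x - g x) < e].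

(* [S(B(X^* ), x, d)] *)
Definition wslice x d : set (dual X) := [set f : dual X | dual_ball f /\ 1 - d < f x].

(* [D(x)] *)
Definition support_functionals x : set (dual X) :=
  [set f : dual X | dual_sphere f /\ f x = 1].

(* [D(A)] *)
Definition support_functionals_on A : set (dual X) :=
  \bigcup_(x in A) support_functionals x.

End Dual.

Arguments dual_ball {R} X.
Arguments dual_sphere {R} X.

(* Main.v *)
(** By Hahn-Banach, a closed convex set at distance [eps] from 0 lies in a half
    space [f >= eps] with [f] of norm one; a ball containing the set and avoiding
    0 then amounts to a slice of the dual ball on which all functionals stay close
    to [f].  Conversely, if the functionals in the slice at [x] are close to [f]
    on [C], then the balls [B[t x, t - eta]] contain [C] once [t] is large.
    Slices, supports near [x], and smoothness at [x] are compared through norming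
    functionals of [x + l y] and [x - l y]. *)

Require Import Defs.
From HB Require Import structures.
From mathcomp Require Import ring lra.

Set Implicit Arguments.
Unset Strict Implicit.
Unset Printing Implicit Defensive.

(** The library takes coefficients in a bundled interval type; this form takes a real [t] with
    explicit bounds. *)
Lemma convex_setP (R : realType) (V : lmodType R) (A : set V) :
  convex_set A <->
  forall (t : R) x y, 0 <= t <= 1 -> A x -> A y -> A (t *: x + (1 - t) *: y).
Proof.
split=> [cA t x y /andP[t0 t1] Ax Ay|cA x y t /set_mem Ax /set_mem Ay].
  have ti : Itv.spec (@Itv.num_sem R) (Itv.Real `[0%Z, 1%Z]) t.
    by rewrite /= /Itv.num_sem num_real in_itv /= t0 t1.
  by have /set_mem := cA x y (Itv.mk ti) (mem_set Ax) (mem_set Ay).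
apply/mem_set/cA => //.
by rewrite ge0 le1.
Qed.

(** * Sublinear functionals and the Hahn-Banach theorem *)

Section HahnBanach.
Variables (R : realType) (V : lmodType R).
Implicit Types (p q : V -> R) (C : set V) (a t : R) (x y c : V).

Definition sublinear p :=
  (forall x y, p (x + y) <= p x + p y) /\
  (forall t x, 0 <= t -> p (t *: x) = t * p x).

Lemma sublinear0 p : sublinear p -> p 0 = 0.
Proof. by case=> _ pZ; rewrite -(scale0r 0) pZ // mul0r. Qed.

Lemma sublinear_ge p x : sublinear p -> - p (- x) <= p x.
Proof.
move=> sp; have := sp.1 x (- x); rewrite subrr sublinear0 //.
by rewrite -lerBlDr sub0r.
Qed.

(** The inequality for [t^-1] at [t *: x] is the reverse of the one for [t] at [x]. *)
Lemma sublinear_le p : p 0 = 0 -> (forall x y, p (x + y) <= p x + p y) ->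
  (forall t x, 0 < t -> p (t *: x) <= t * p x) -> sublinear p.
Proof.
move=> p0 pD pZ; split=> // t x; rewrite le_eqVlt => /predU1P[<-|t0].
  by rewrite scale0r mul0r.
apply/eqP; rewrite eq_le pZ //= -ler_pdivlMl // mulrC.
rewrite -{1}[x](scalerK (lt0r_neq0 t0)) mulrC.
by rewrite pZ // invr_gt0.
Qed.

(* The largest sublinear functional below [p] that is at most [- a] on [- C]. *)
Definition tilt p C a x : R :=
  inf [set p (x + t *: c) - t * a | t in [set t | 0 <= t] & c in C].

Section Tilt.
Variables (p : V -> R) (C : set V) (a : R).
Hypotheses (sp : sublinear p) (cC : convex_set C) (C0 : C !=set0).
Hypothesis pC : forall c, C c -> a <= p c.

(** Apply subadditivity to [t c = (x + t c) + (- x)], with [t a <= p (t c)]. It makes the infimum in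
    [tilt] a genuine one. *)
Lemma tilt_lbound x t c : 0 <= t -> C c -> - p (- x) <= p (x + t *: c) - t * a.
Proof.
move=> t0 Cc; have := sp.1 (x + t *: c) (- x).
rewrite addrAC subrr add0r sp.2 // => h.
have : t * a <= t * p c by rewrite ler_wpM2l // pC.
lra.
Qed.

Lemma tilt_has_lbound x :
  has_lbound [set p (x + t *: c) - t * a | t in [set t | 0 <= t] & c in C].
Proof. by exists (- p (- x)) => _ [t t0 [c Cc <-]]; exact: tilt_lbound. Qed.

Lemma tilt_le x t c : 0 <= t -> C c -> tilt p C a x <= p (x + t *: c) - t * a.
Proof.
by move=> t0 Cc; apply: ge_inf; [exact: tilt_has_lbound|exists t => //; exists c].
Qed.

Lemma tilt_ge x b :
  (forall t c, 0 <= t -> C c -> b <= p (x + t *: c) - t * a) ->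
  b <= tilt p C a x.
Proof.
move=> h; apply: lb_le_inf; last by move=> _ [t t0 [c Cc <-]]; exact: h.
by have [c Cc] := C0; exists (p (x + 0 *: c) - 0 * a); exists 0 => //=; exists c.
Qed.

Lemma tilt_le_base x : tilt p C a x <= p x.
Proof.
have [c Cc] := C0; have := @tilt_le x 0 c (lexx _) Cc.
by rewrite scale0r addr0 mul0r subr0.
Qed.

Lemma tiltN c : C c -> tilt p C a (- c) <= - a.
Proof.
move=> Cc; have := @tilt_le (- c) 1 c ler01 Cc.
by rewrite scale1r addNr sublinear0 // mul1r sub0r.
Qed.

Lemma tilt_sublinear : sublinear (tilt p C a).
Proof.
apply: sublinear_le => [|x y|s x s0].
- apply/eqP; rewrite eq_le -{1}(sublinear0 sp) tilt_le_base /=.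
  apply: tilt_ge => t c t0 Cc; have := @tilt_lbound 0 t c t0 Cc.
  by rewrite oppr0 sublinear0 // oppr0.
- rewrite -lerBlDr; apply: tilt_ge => t c t0 Cc.
  rewrite lerBlDr -lerBlDl; apply: tilt_ge => s d s0 Cd; rewrite lerBlDl.
  have [ts0|ts_neq0] := eqVneq (t + s) 0.
    have [-> ->] : t = 0 /\ s = 0 by split; lra.
    rewrite !scale0r !addr0 !mul0r !subr0.
    by rewrite (le_trans (tilt_le_base _)) // sp.1.
  have ts_gt0 : 0 < t + s by lra.
  (* The points [c] and [d] merge into one point of [C] with coefficient [t + s], which is where
     convexity enters. *)
  pose k := t / (t + s).
  have k01 : 0 <= k <= 1.
    by rewrite /k divr_ge0 ?(ltW ts_gt0) //= ler_pdivrMr // mul1r lerDl.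
  have Ce := (convex_setP C).1 cC k c d k01 Cc Cd.
  have := tilt_le (x + y) (ltW ts_gt0) Ce; move/le_trans; apply.
  have -> : (t + s) *: (k *: c + (1 - k) *: d) = t *: c + s *: d.
    rewrite scalerDr !scalerA; congr (_ *: _ + _ *: _); rewrite /k; field => //.
  rewrite addrACA mulrDl.
  have := sp.1 (x + t *: c) (y + s *: d); lra.
- rewrite -ler_pdivrMl //; apply: tilt_ge => t c t0 Cc; rewrite ler_pdivrMl //.
  have st0 : 0 <= s * t by rewrite mulr_ge0 // ltW.
  apply: (le_trans (tilt_le (s *: x) st0 Cc)).
  rewrite -scalerA -scalerDr sp.2; last exact: ltW.
  by rewrite mulrBr mulrA.
Qed.

End Tilt.

(** Zorn's lemma for the reversed pointwise order: the pointwise infimum of a nonempty chain is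
    sublinear, and it is finite because every member is at least [- p (- x)] at [x]. *)
Lemma exists_minimal_sublinear p : sublinear p ->
  exists q, [/\ sublinear q, (forall x, q x <= p x) &
    forall q', sublinear q' -> (forall x, q' x <= q x) -> q' = q].
Proof.
move=> sp.
pose T := {q | sublinear q /\ forall x, q x <= p x}.
pose le_T (s t : T) := `[< forall x, sval t x <= sval s x >].
have [||s t|A tA|[q [sq qp]] qmin] := @Zorn T le_T.
- by move=> t; apply/asboolP.
- move=> r s t /asboolP rs /asboolP st; apply/asboolP => x.
  exact: le_trans (st x) (rs x).
- case: s t => [s hs] [t ht] /asboolP /= st /asboolP /= ts.
  by apply: eq_exist; apply/funext => x; apply/eqP; rewrite eq_le st ts.
- have [[s0 As0]|A0] := pselect (A !=set0); last first.
    exists (exist _ p (conj sp (fun x => lexx _))) => s As.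
    by exfalso; apply: A0; exists s.
  pose E x := [set sval s x | s in A].
  have Elb x : has_lbound (E x).
    exists (- p (- x)) => _ [[r [sr rp]] _ <-] /=.
    by rewrite (le_trans _ (sublinear_ge x sr)) // lerN2.
  have infE s x : A s -> inf (E x) <= sval s x.
    by move=> As; apply: ge_inf => //; exists s.
  have Einf x b : (forall s, A s -> b <= sval s x) -> b <= inf (E x).
    move=> h; apply: lb_le_inf; last by move=> _ [s As <-]; exact: h.
    by exists (sval s0 x), s0.
  have sE : sublinear (fun x => inf (E x)).
    apply: sublinear_le => [|x y|t x t0].
    + apply/eqP; rewrite eq_le; apply/andP; split.
        by rewrite (le_trans (infE _ _ As0)) // sublinear0 //; case: (svalP s0).
      by apply: Einf => s _; rewrite sublinear0 //; case: (svalP s).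
    + rewrite -lerBlDr; apply: (Einf) => s As.
      rewrite lerBlDr -lerBlDl; apply: Einf => t At; rewrite lerBlDl.
      (* Of two members of the chain, the smaller one bounds the infimum at [x + y]. *)
      have [/asboolP le_st|/asboolP le_ts] := tA s t As At.
      * rewrite (le_trans (infE t _ At)) //.
        by rewrite (le_trans ((svalP t).1.1 x y)) // lerD2r; exact: le_st.
      * rewrite (le_trans (infE s _ As)) //.
        by rewrite (le_trans ((svalP s).1.1 x y)) // lerD2l; exact: le_ts.
    + rewrite -ler_pdivrMl //; apply: (Einf) => s As; rewrite ler_pdivrMl //.
      by rewrite (le_trans (infE s _ As)) // (svalP s).1.2 // ltW.
  have Ep x : inf (E x) <= p x.
    by rewrite (le_trans (infE _ _ As0)) //; case: (svalP s0).
  exists (exist _ (fun x => inf (E x)) (conj sE Ep)) => s As; apply/asboolP => x /=.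
  exact: infE.
exists q; split=> // q' sq' q'q.
have q'p x : q' x <= p x by exact: le_trans (q'q x) (qp x).
have := qmin (exist _ q' (conj sq' q'p)).
by move=> /(_ (asboolT q'q))/(congr1 sval).
Qed.

(* Tilting a minimal sublinear functional [q] along [y] does not change it,
   which forces [q x + q y <= q (x + y)]. *)
Lemma hahn_banach p : sublinear p ->
  exists f : {linear V -> R^o}, forall x, f x <= p x.
Proof.
move=> /exists_minimal_sublinear[q [sq qp qmin]].
have qD x y : q (x + y) = q x + q y.
  apply/eqP; rewrite eq_le sq.1 /=.
  have cy : convex_set [set y].
    apply/convex_setP => t _ _ _ -> ->.
    by rewrite -scalerDl addrC subrK scale1r.
  have y0 : [set y] !=set0 by exists y.
  have qy c : [set y] c -> q y <= q c by move=> ->.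
  have tq : tilt q [set y] (q y) = q.
    by apply: qmin; [exact: tilt_sublinear|exact: tilt_le_base].
  have := tilt_le sq qy x ler01 (erefl y).
  by rewrite tq scale1r mul1r lerBrDr.
have qN x : q (- x) = - q x.
  by apply/eqP; rewrite -subr_eq0 opprK -qD addNr sublinear0.
have q_linear : linear (q : V -> R^o).
  move=> t x y; rewrite qD; congr (_ + _).
  have [t0|t0] := leP 0 t; first by rewrite sq.2.
  have Nt0 : 0 <= - t by rewrite oppr_ge0 ltW.
  by rewrite -[LHS]opprK -qN -scaleNr sq.2 // mulNr opprK.
pose f : {linear V -> R^o} :=
  HB.pack (q : V -> R^o) (GRing.isLinear.Build R V R^o *:%R _ q_linear).
by exists f.
Qed.

End HahnBanach.

(** The sign of [b] covers the empty set, whose [sup] is 0. *)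
Lemma sup_le_nonneg (R : realType) (E : set R) (b : R) :
  0 <= b -> ubound E b -> sup E <= b.
Proof.
move=> b0 Eb; have [->|/set0P E0] := eqVneq E set0; first by rewrite sup0.
exact: ge_sup.
Qed.

(** * Dual norm, separation, and distances of sets from the origin *)

Section Dual.
Variables (R : realType) (X : normedModType R).
Implicit Types (A C : set X) (f g h : dual X) (x y z c u : X) (e d r b : R).

Lemma norm_on_le A (f : X -> R) b : 0 <= b ->
  (forall x, A x -> `|f x| <= b) -> norm_on A f <= b.
Proof.
by move=> b0 fb; apply: sup_le_nonneg => // _ [x Ax <-]; exact: fb.
Qed.

Lemma dual_has_ubound f : has_ubound [set `|f x| | x in unit_ball X].
Proof.
have /linear_bounded_continuous/linear_boundedP f_bd := @dual_continuous _ _ f.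
near (pinfty_nbhs R) => M.
exists M => _ [x x1 <-].
have M0 : 0 <= M by near: M; apply: nbhs_pinfty_ge; rewrite real0.
have : `|f x| <= M * `|x| by move: x {x1}; near: M.
by move=> /le_trans; apply; rewrite ler_piMr.
Unshelve. all: by end_near. Qed.

Lemma dual_norm_ge0 f : 0 <= dual_norm f.
Proof.
apply: ub_le_sup; first exact: dual_has_ubound.
by exists 0; rewrite ?linear0 /unit_ball /= normr0.
Qed.

Lemma dual_norm_ge f x : `|f x| <= dual_norm f * `|x|.
Proof.
have [->|x0] := eqVneq x 0; first by rewrite linear0 !normr0 mulr0.
have nx : 0 < `|x| by rewrite normr_gt0.
rewrite -ler_pdivrMr //.
have -> : `|f x| / `|x| = `|f (`|x|^-1 *: x)|.
  rewrite linearZ normrM mulrC ger0_norm //.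
apply: ub_le_sup; first exact: dual_has_ubound.
exists (`|x|^-1 *: x) => //.
by rewrite /unit_ball /= normrZ ger0_norm ?invr_ge0 // mulVf // gt_eqF.
Qed.

Lemma dual_ball_le f x : dual_ball X f -> `|f x| <= `|x|.
Proof.
move=> f1; apply: le_trans (dual_norm_ge f x) _.
by rewrite ler_piMl.
Qed.

Lemma dual_sphere_ball f : dual_sphere X f -> dual_ball X f.
Proof. by rewrite /dual_sphere /dual_ball /= => ->. Qed.

Lemma dual_sphere_adherent f e : dual_sphere X f -> 0 < e ->
  exists2 u, `|u| <= 1 & 1 - e < f u.
Proof.
move=> f1 e0.
have [|_ [u u1 <-]] := @sup_adherent R [set `|f x| | x in unit_ball X] e e0.
  split; last exact: dual_has_ubound.
  by exists `|f 0|, 0 => //; rewrite /unit_ball /= normr0.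
rewrite -[sup _]/(dual_norm f) f1 => fu.
have [f0|f0] := leP 0 (f u); first by exists u => //; rewrite -(ger0_norm f0).
exists (- u); first by rewrite normrN.
by move: fu; rewrite ltr0_norm // linearN.
Qed.

(** Since [C] lies in the unit ball, the values [|f y - g y|] are bounded by the sum of the dual
    norms, so [sup] really dominates each of them. *)
Lemma seminorm_ball_lt C f g e x : C `<=` unit_ball X ->
  seminorm_ball C f e g -> C x -> `|f x - g x| < e.
Proof.
move=> C1 fg Cx; apply: le_lt_trans fg.
apply: ub_le_sup; last by exists x.
exists (dual_norm f + dual_norm g) => _ [y /C1 y1 <-].
have h (k : dual X) : `|k y| <= dual_norm k.
  by apply: ub_le_sup; [exact: dual_has_ubound|exists y].
by apply: le_trans (ler_normB _ _) _; apply: lerD.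
Qed.

Lemma bounded_linear_dual (f : {linear X -> R^o}) :
  (forall x, f x <= `|x|) -> exists g, g =1 f /\ dual_ball X g.
Proof.
move=> f_le.
have f_norm x : `|f x| <= `|x|.
  by rewrite ler_norml f_le lerNl -linearN -[leRHS]normrN f_le.
have f_cont : continuous f.
  apply/linear_bounded_continuous/linear_boundedP.
  near=> M => x; rewrite (le_trans (f_norm x)) // ler_peMl //.
exists (Dual f_cont); split=> //.
by apply: norm_on_le => // x x1; apply: le_trans (f_norm x) _.
Unshelve. all: by end_near. Qed.

(** A linear functional below the norm tilted along [C] is at most the norm, and at least [e] on
    [C]. Its dual norm lies in []0, 1]], so normalizing it only increases its values on [C]. *)
Lemma separation C e : convex_set C -> C !=set0 -> 0 < e ->
  (forall c, C c -> e <= `|c|) ->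
  exists2 f, dual_sphere X f & forall c, C c -> e <= f c.
Proof.
move=> cC C0 e0 Ce.
have sn : @sublinear R X (fun x => `|x|).
  by split=> [x y|t x t0]; [exact: ler_normD|rewrite normrZ ger0_norm].
have [f0 f0_le] := hahn_banach (tilt_sublinear sn cC C0 Ce).
have [|f [ff0 f1]] := @bounded_linear_dual f0.
  by move=> x; apply: le_trans (f0_le x) (tilt_le_base sn C0 Ce x).
have fC c : C c -> e <= f c.
  move=> Cc; rewrite ff0 -[c]opprK linearN lerNr.
  exact: le_trans (f0_le _) (tiltN sn Ce Cc).
have nf : 0 < dual_norm f.
  have [c Cc] := C0; have := lt_le_trans e0 (fC c Cc).
  rewrite ltNge => fc; rewrite ltNge; apply: contra fc => nf.
  apply: le_trans (ler_norm _) (le_trans (dual_norm_ge f c) _).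
  exact: mulr_le0_ge0.
pose k := (dual_norm f)^-1.
have k0 : 0 < k by rewrite invr_gt0.
have [|g [gE g1]] := @bounded_linear_dual (k \*: f).
  move=> x /=; rewrite -[leRHS]mul1r -(mulVf (lt0r_neq0 nf)) -mulrA.
  by rewrite ler_pM2l // (le_trans (ler_norm _) (dual_norm_ge f x)).
have {}gE x : g x = k * f x by rewrite gE.
exists g => [|c Cc]; last first.
  rewrite gE (le_trans (fC c Cc)) // ler_peMl ?(le_trans (ltW e0) (fC c Cc)) //.
  by rewrite /k invf_ge1.
apply/eqP; rewrite eq_le g1 /= -(ler_pM2l nf) mulr1.
apply: norm_on_le => [|x x1]; first by rewrite mulr_ge0 ?dual_norm_ge0.
have -> : f x = dual_norm f * g x by rewrite gE mulVKf ?lt0r_neq0.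
rewrite normrM gtr0_norm // ler_pM2l //.
by apply: ub_le_sup; [exact: dual_has_ubound|exists x].
Qed.

(** Separate the singleton of [x] from 0 at level [|x|]. *)
Lemma support_functional_ex x : x != 0 ->
  exists2 f, dual_sphere X f & f x = `|x|.
Proof.
rewrite -normr_gt0 => x0.
have cx : convex_set [set x].
  apply/convex_setP => t _ _ _ -> ->.
  by rewrite -scalerDl addrC subrK scale1r.
have [||c ->//|f f1 fx] := @separation [set x] `|x| cx; first by exists x.
  by [].
exists f => //; apply/eqP; rewrite eq_le fx // andbT.
exact: le_trans (ler_norm _) (dual_ball_le x (dual_sphere_ball f1)).
Qed.

Lemma dist_le C c : C c -> dist 0 C <= `|c|.
Proof.
move=> Cc; apply: ge_inf; last by exists c; rewrite // sub0r normrN.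
by exists 0 => _ [z _ <-].
Qed.

Lemma dist_ge C e : C !=set0 -> (forall c, C c -> e <= `|c|) -> e <= dist 0 C.
Proof.
move=> [c Cc] Ce; apply: lb_le_inf; first by exists `|0 - c|, c.
by move=> _ [z Cz <-]; rewrite sub0r normrN; exact: Ce.
Qed.

Lemma dist_gt0_nonempty x C : 0 < dist x C -> C !=set0.
Proof.
move=> d0; apply: contrapT => C0; move: d0.
suff -> : C = set0 by rewrite /dist image_set0 inf0 ltxx.
by apply/seteqP; split=> // y Cy; case: C0; exists y.
Qed.

Lemma dist_cball_gt z r e : 0 <= r -> e < `|z| - r -> e < dist 0 (cball z r).
Proof.
move=> r0 ezr; apply: lt_le_trans ezr _; apply: dist_ge => [|c].
  by exists z; rewrite /cball /closed_ball_ /= subrr normr0.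
rewrite /cball /closed_ball_ /=; have := ler_normD (z - c) c; rewrite subrK; lra.
Qed.

(** A positive distance keeps 0 out of the ball, so [r < |z|]; then [z - (r / |z|) z] is a point of
    the ball of norm [|z| - r]. *)
Lemma lt_dist_cball z r e : 0 <= e -> 0 <= r ->
  e < dist 0 (cball z r) -> e < `|z| - r.
Proof.
move=> e0 r0 ezr.
have z0 : r < `|z|.
  rewrite ltNge; apply/negP => zr.
  have : cball z r 0 by rewrite /cball /closed_ball_ /= subr0.
  by move=> /dist_le; rewrite normr0 leNgt (le_lt_trans e0 ezr).
have nz : `|z| != 0 by rewrite gt_eqF // (le_lt_trans r0).
have : cball z r (z - (r / `|z|) *: z).
  rewrite /cball /closed_ball_ /= opprB addrC subrK normrZ normrM normfV.
  by rewrite normr_id divfK // ger0_norm.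
move=> /dist_le; rewrite -[X in X - _]scale1r -scalerBl normrZ.
rewrite ger0_norm; last first.
  by rewrite subr_ge0 ler_pdivrMr ?mul1r ?ltW // (le_lt_trans r0).
by rewrite mulrBl divfK // mul1r; exact: lt_le_trans.
Qed.

Lemma enlarge0 C : enlarge C 0 = C.
Proof.
apply/seteqP; split=> [_ [y Cy [u _ <-]]|c Cc]; first by rewrite scale0r addr0.
by exists c => //; exists 0; rewrite ?scaler0 ?addr0 // /unit_ball /= normr0.
Qed.

(** Moving [c] straight towards 0 by [b] stays in the enlargement and lowers the norm by [b]. If
    [|c| <= b] with [b] positive, 0 itself would be reached, against [0 < e]. *)
Lemma dist_enlarge_ge C e b c : 0 < e -> 0 <= b ->
  e <= dist 0 (enlarge C b) -> C c -> e + b <= `|c|.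
Proof.
move=> e0 b0 eCb Cc.
have eD u : `|u| <= 1 -> e <= `|c + b *: u|.
  by move=> u1; apply: le_trans eCb (dist_le _); exists c => //; exists u.
have [cb|bc] := leP `|c| b.
  have [b_eq0|b_neq0] := eqVneq b 0.
    have := eD 0; rewrite normr0 ler01 => /(_ isT).
    by rewrite b_eq0 scale0r !addr0.
  have bp : 0 < b by rewrite lt_def b_neq0.
  have := eD (- (b^-1 *: c)); rewrite normrN normrZ gtr0_norm ?invr_gt0 //.
  rewrite ler_pdivrMl // mulr1 => /(_ cb).
  by rewrite scalerN scalerA divff // scale1r subrr normr0 leNgt e0.
have nc : 0 < `|c| by exact: le_lt_trans bc.
have := eD (- (`|c|^-1 *: c)); rewrite normrN normrZ gtr0_norm ?invr_gt0 //.
rewrite mulVf ?gt_eqF // lexx => /(_ isT).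
rewrite scalerN scalerA -[X in X - _]scale1r -scalerBl normrZ ger0_norm.
  by rewrite mulrBl mul1r divfK ?gt_eqF // lerBrDr.
by rewrite subr_ge0 ler_pdivrMr // mul1r ltW.
Qed.

Lemma enlarge_sub_cball C z r b : 0 <= b ->
  C `<=` cball z r -> enlarge C b `<=` cball z (r + b).
Proof.
move=> b0 Czr _ [c /Czr + [u u1 <-]]; rewrite /cball /closed_ball_ /= => zc.
rewrite opprD addrA (le_trans (ler_normB _ _)) // lerD // normrZ ger0_norm //.
by rewrite ler_piMr.
Qed.

End Dual.

(** * Slices, supports, smoothness and separating balls *)

Section Properties.
Variables (R : realType) (X : normedModType R) (F : set (set X)).
Implicit Types (A C : set X) (f g h : dual X) (x y z c u : X).
Implicit Types (eps eta e d r b beta delta M K l : R).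

(** This predicate and the next three are the inner parts of the equivalent conditions with all
    constants exposed, so that each implication shows how they change. *)
Definition separating_balls eps beta M eta K :=
  forall C, F C -> closed C -> convex_set C ->
    diam C <= M -> eps <= dist 0 (enlarge C beta) ->
    exists z r, [/\ 0 < r <= K, enlarge C beta `<=` cball z r
      & eta < dist 0 (cball z r)].

Definition small_slices eps delta :=
  forall C, F C -> C `<=` unit_ball X ->
    forall f, dual_sphere X f ->
      exists2 x, unit_sphere X x & wslice x delta `<=` seminorm_ball C f eps.

Definition small_supports eps delta :=
  forall C, F C -> C `<=` unit_ball X ->
    forall f, dual_sphere X f ->
      exists2 x, unit_sphere X x &
        support_functionals_on (unit_sphere X `&` ball x delta)
          `<=` seminorm_ball C f eps.

Definition smooth_supports eps delta :=
  forall C, F C -> C `<=` unit_ball X ->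
    forall f, dual_sphere X f ->
      exists2 x, M_set eps delta C x &
        support_functionals x `<=` seminorm_ball C f eps.

(** [C] itself has distance at least [eps + beta] from 0. Growing the radius of a ball around it by
    [beta] absorbs the enlargement and costs [beta] in distance. *)
Lemma separating_balls_enlarge eps beta M eta K :
  0 < eps -> 0 <= beta -> 0 < eta ->
  separating_balls (eps + beta) 0 M (eta + beta) K ->
  separating_balls eps beta M eta (K + beta).
Proof.
move=> eps0 beta0 eta0 sepK C FC clC cC CM epsC.
have [|z [r [/andP[r0 rK]]]] := sepK C FC clC cC CM.
  rewrite enlarge0; apply: dist_ge => [|c Cc].
    by have [_ [c Cc _]] := dist_gt0_nonempty (lt_le_trans eps0 epsC); exists c.
  exact: dist_enlarge_ge epsC Cc.
rewrite enlarge0 => Czr etaz; exists z, (r + beta).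
split; first by rewrite ltr_wpDr // lerD2r.
  exact: enlarge_sub_cball.
have etab : 0 <= eta + beta by lra.
apply: dist_cball_gt; first by lra.
by have := lt_dist_cball etab (ltW r0) etaz; lra.
Qed.

(** A norm-one functional supporting the ball at [z] satisfies [h x >= 1 - |z - x|], so it lies in
    the slice at [x]. *)
Lemma small_slices_supports eps delta :
  small_slices eps delta -> small_supports eps delta.
Proof.
move=> sl C FC C1 f f1; have [x x1 xsl] := sl C FC C1 f f1.
exists x => // h [z [z1 xz] [h1 hz]]; apply: xsl; split.
  exact: dual_sphere_ball.
have := dual_ball_le (z - x) (dual_sphere_ball h1).
move: xz; rewrite -ball_normE /ball_ /= distrC => zx /(le_lt_trans)/(_ zx).
by rewrite ltr_norml linearB /= hz; lra.
Qed.

(** Adding [w] moves [x] by at most [l]; normalizing then moves the point by the difference of its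
    norm from 1, again at most [l]. *)
Lemma normalize_near x w l : `|x| = 1 -> `|w| <= l -> l < 1 ->
  x + w != 0 /\ `|x - `|x + w|^-1 *: (x + w)| <= 2 * l.
Proof.
move=> x1 wl l1; set z := x + w.
have z1 : `| `|z| - 1| <= l.
  rewrite -x1 (le_trans (ler_dist_dist _ _)) // /z.
  by rewrite addrAC subrr add0r.
have z0 : 0 < `|z| by move: z1; rewrite ler_norml; lra.
split; first by rewrite -normr_gt0.
have -> : x - `|z|^-1 *: z = - w + (z - `|z|^-1 *: z).
  by rewrite addrA; congr (_ - _); rewrite /z addrC addrK.
apply: le_trans (ler_normD _ _) _; rewrite normrN mulr_natl mulr2n lerD //.
rewrite -[X in X - _]scale1r -scalerBl normrZ -[X in _ * X]normr_id -normrM.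
by rewrite mulrBl mul1r mulVf ?gt_eqF.
Qed.

(* Norming functionals [h1], [h2] of [x + l y] and [x - l y] bound the symmetric
   difference quotient at [x] by [h1 y - h2 y]. *)
Lemma small_supports_smooth eps delta : 0 < eps -> 0 < delta ->
  small_supports (eps / 4) delta ->
  smooth_supports eps (Num.min (delta / 2) (1 / 2)).
Proof.
move=> eps0 delta0 ss C FC C1 f f1.
have [x x1 xs] := ss C FC C1 f f1.
have near_support w l : `|w| <= l -> l < 1 -> 2 * l < delta ->
    exists2 h, dual_ball X h /\ seminorm_ball C f (eps / 4) h
      & h (x + w) = `|x + w|.
  move=> wl l1 ld; have [z0 zx] := normalize_near x1 wl l1.
  have [h h1 hz] := support_functional_ex z0.
  have nz : `|x + w| != 0 by rewrite normr_eq0.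
  exists h => //; split; first exact: dual_sphere_ball.
  apply: xs; exists (`|x + w|^-1 *: (x + w)).
    split; first by rewrite /unit_sphere /= normrZ normfV normr_id mulVf.
    by rewrite -ball_normE /ball_ /=; exact: le_lt_trans ld.
  by split=> //; rewrite linearZ /= hz; exact: mulVf.
exists x.
  split=> //; apply: (@le_lt_trans _ _ (eps / 2)); last by lra.
  apply: sup_le_nonneg => [|_ [l /= /andP[l0 +] [y Cy <-]]]; first by lra.
  (* The two bounds on [l] give [2 * l < delta] and [l < 1], as [near_support] requires. *)
  rewrite lt_min => /andP[ld lh].
  rewrite ler_pdivrMr //.
  have ly : `|l *: y| <= l by rewrite normrZ gtr0_norm // ler_piMr ?C1 // ltW.
  have Nly : `|- (l *: y)| <= l by rewrite normrN.
  have [||h [h1 hf] <-] := near_support _ _ ly; [lra|lra|].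
  have [||k [k1 kf] <-] := near_support _ _ Nly; [lra|lra|].
  have := seminorm_ball_lt C1 hf Cy; have := seminorm_ball_lt C1 kf Cy.
  have := dual_ball_le x h1; have := dual_ball_le x k1.
  rewrite (x1 : `|x| = 1) !ler_norml !ltr_norml !linearD !linearN !linearZ /=.
  rewrite /GRing.scale /=.
  move=> /andP[_ kx] /andP[_ hx] /andP[ky1 ky2] /andP[hy1 hy2].
  (* Both [h] and [k] are within [eps / 4] of [f] at [y]. *)
  have : l * (h y - k y) <= l * (eps / 2) by rewrite ler_pM2l //; lra.
  lra.
move=> h hx; apply: (@lt_trans _ _ (eps / 4)); last by lra.
by apply: xs; exists x => //; split=> //; exact: ballxx.
Qed.

(** For [g] in the slice and [h] supporting at [x], add [h (x + l y) <= |x + l y|] and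
    [g (x - l y) <= |x - l y|]: smoothness and [1 - g x < l eps / 4] bound [h y - g y] by [eps / 2].
    Exchanging [h] and [g] bounds the absolute value, and [h] is within [eps / 4] of [f]. *)
Lemma smooth_supports_slices eps delta : 0 < eps -> 0 < delta ->
  smooth_supports (eps / 4) delta ->
  small_slices eps (Num.min (delta / 2 * (eps / 4)) (1 / 2)).
Proof.
move=> eps0 delta0 ss C FC C1 f f1.
have [x [x1 xM] xs] := ss C FC C1 f f1.
exists x => // g [g1]; rewrite ltrBlDl -ltrBlDr lt_min => /andP[gx _].
have x0 : x != 0 by rewrite -normr_gt0 (x1 : `|x| = 1).
have [h h1 hx] := support_functional_ex x0.
rewrite (x1 : `|x| = 1) in hx.
apply: (@le_lt_trans _ _ (3 * (eps / 4))); last by lra.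
apply: norm_on_le => [|y Cy]; first by lra.
set l := delta / 2 in gx *.
have l0 : 0 < l by rewrite /l; lra.
have lE : l * (2 * (eps / 4)) = l * (eps / 4) + l * (eps / 4) by ring.
have : `|x + l *: y| + `|x - l *: y| - 2 < l * (eps / 4).
  rewrite mulrC -ltr_pdivrMr //; apply: le_lt_trans xM.
  apply: ub_le_sup; last by exists l; [rewrite /l /=; lra|exists y].
  (* The quotients are at most 2 because [C] lies in the unit ball, so the supremum in [d1] is
     finite. *)
  exists 2 => _ [k /= /andP[k0 _] [z /C1 z1 <-]]; rewrite ler_pdivrMr //.
  have := ler_normD x (k *: z); have := ler_normB x (k *: z).
  rewrite (x1 : `|x| = 1) normrZ gtr0_norm //.
  have : k * `|z| <= k by rewrite ler_piMr // ltW.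
  lra.
have h_ball := dual_sphere_ball h1.
have := dual_ball_le (x + l *: y) g1; have := dual_ball_le (x + l *: y) h_ball.
have := dual_ball_le (x - l *: y) g1; have := dual_ball_le (x - l *: y) h_ball.
rewrite !ler_norml !linearD !linearN !linearZ /= hx /GRing.scale /=.
move=> /andP[_ h2] /andP[_ g2] /andP[_ h3] /andP[_ g3] xl.
have hg : `|h y - g y| <= 2 * (eps / 4).
  have : l * (h y - g y) <= l * (2 * (eps / 4)) by lra.
  have : l * (g y - h y) <= l * (2 * (eps / 4)) by lra.
  by rewrite !(ler_pM2l l0) ler_norml; lra.
have fh := seminorm_ball_lt C1 (xs h (conj h1 hx)) Cy.
move: hg fh; rewrite !ler_norml ltr_norml.
by move=> /andP[hg1 hg2] /andP[fh1 fh2]; lra.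
Qed.

Lemma scaled_mem C k : compatible_class F -> F C -> F [set k *: y | y in C].
Proof.
move=> hF FC; have := compatible_affine hF k 0 FC.
by congr F; apply: eq_imagel => y _; rewrite addr0.
Qed.

Lemma norm_le_diam C x y : bounded_set C -> C x -> C y -> `|x - y| <= diam C.
Proof.
move=> [M [_ bC]] Cx Cy; apply: ub_le_sup; last by exists x => //; exists y.
exists ((M + 1) + (M + 1)) => _ [z Cz [w Cw <-]].
by apply: le_trans (ler_normB _ _) _; rewrite lerD // bC // ltrDl.
Qed.

(* Far from the origin a ball centred in [C] will do.  Otherwise [x] supplies a
   slice of functionals that are large on [C], and [B[t x, t - eta']] contains
   [C] for large [t], since a functional norming [t x - c] lies in the slice. *)
Lemma small_slices_balls eps M eta delta :
  compatible_class F -> 0 < eta < eps -> 2 <= M -> 0 < delta < 1 ->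
  small_slices ((eps - eta) / 2 / (M + eps)) delta ->
  exists2 K, 0 < K & separating_balls eps 0 M eta K.
Proof.
move=> hF /andP[eta0 etaeps] M2 /andP[delta0 delta1] sl.
set L := M + eps in sl; have L0 : 0 < L by rewrite /L; lra.
(* [eta'] lies strictly between [eta] and the lower bound [(eps + eta) / 2] of slice functionals on
   [C]; [t] is chosen so that [t (1 - delta) = t - (eta' + L)]. *)
pose eta' := eta + (eps - eta) / 4.
pose t := (eta' + L) / delta.
have et : eta' + L <= t.
  by rewrite /t ler_pdivlMr // ler_piMr ?ltW // /eta'; lra.
exists (t + M) => [|C FC clC cC CM]; first by rewrite /eta' in et; lra.
rewrite enlarge0 => epsC.
have eps0 : 0 < eps by lra.
have C0 := dist_gt0_nonempty (lt_le_trans eps0 epsC).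
have Ceps c : C c -> eps <= `|c| by move=> Cc; exact: le_trans (dist_le Cc).
have diamC x y : C x -> C y -> `|x - y| <= M.
  move=> Cx Cy; apply: le_trans CM; apply: norm_le_diam => //.
  exact: compatible_bounded FC.
(* If some [c] in [C] has norm at least [M + eps], the ball [B[c, M]] contains [C] and has distance
   at least [eps] from 0. *)
have [[c [Cc Lc]]|Cfar] := pselect (exists c, C c /\ L <= `|c|).
  exists c, M; split; first by rewrite /eta' in et; lra.
    by move=> y Cy; exact: diamC.
  by apply: dist_cball_gt; rewrite /L in Lc; lra.
have CL c : C c -> `|c| <= L.
  move=> Cc; rewrite leNgt; apply/negP => Lc; apply: Cfar; exists c.
  by split=> //; exact: ltW.
have [f f1 fC] := separation cC C0 eps0 Ceps.
(* [C] is scaled into the unit ball; the [M + eps] in the denominator of the slice tolerance undoes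
   this scaling. *)
have C'1 : [set L^-1 *: y | y in C] `<=` unit_ball X.
  move=> _ [y Cy <-]; rewrite /unit_ball /= normrZ gtr0_norm ?invr_gt0 //.
  by rewrite ler_pdivrMl // mulr1 CL.
have [x x1 xsl] := sl _ (scaled_mem L^-1 hF FC) C'1 f f1.
have slC g c : wslice x delta g -> C c -> (eps + eta) / 2 < g c.
  move=> /xsl gf Cc.
  have : [set L^-1 *: y | y in C] (L^-1 *: c) by exists c.
  move=> /(seminorm_ball_lt C'1 gf); rewrite !linearZ /= -scalerDr.
  rewrite normrM gtr0_norm ?invr_gt0 // mulrC ltr_pM2r ?invr_gt0 //.
  rewrite ltr_norml; have := fC c Cc; lra.
have t0 : 0 < t by rewrite /eta' in et; lra.
have ntx : `|t *: x| = t by rewrite normrZ (x1 : `|x| = 1) mulr1 gtr0_norm.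
exists (t *: x), (t - eta'); split.
- by rewrite /eta' in et *; lra.
- move=> c Cc; rewrite /cball /closed_ball_ /= leNgt; apply/negP => tc.
  have z0 : t *: x - c != 0.
    by rewrite -normr_gt0; apply: le_lt_trans tc; rewrite /eta' in et *; lra.
  have [h h1] := support_functional_ex z0; rewrite linearB linearZ /= => hz.
  have h_ball := dual_sphere_ball h1.
  have hslice : wslice x delta h.
    split=> //; rewrite ltrBlDr -ltrBlDl.
    have := dual_ball_le c h_ball; rewrite ler_norml => /andP[hc _].
    have := CL c Cc => cL.
    have : t * (1 - delta) < t * h x.
      have -> : t * (1 - delta) = t - (eta' + L).
        by rewrite mulrBr mulr1 /t mulfVK ?gt_eqF.
      by move: hz; rewrite /GRing.scale /=; lra.
    by rewrite ltr_pM2l //; lra.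
  have := slC h c hslice Cc.
  have := dual_ball_le x h_ball; rewrite (x1 : `|x| = 1) ler_norml => /andP[_ hx].
  have : t * h x <= t by rewrite ler_piMr // ltW.
  move: hz tc; rewrite /GRing.scale /= /eta'; lra.
apply: dist_cball_gt; first by rewrite /eta' in et *; lra.
by rewrite ntx /eta'; lra.
Qed.

End Properties.

(** * Absolutely convex combinations and closed hulls *)

Section Hull.
Variables (R : realType) (X : normedModType R).
Implicit Types (A B : set X) (x y : X) (s t r : R).

(** With [k = |s| + |t|], the vector is the convex combination, with weights [|s| / k] and
    [|t| / k], of [x] and [y] multiplied by [k] and the signs of [s] and [t]. *)
Lemma absolutely_convex_comb A s t x y : absolutely_convex A -> A x -> A y ->
  `|s| + `|t| <= 1 -> A (s *: x + t *: y).
Proof.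
move=> [cA bA] Ax Ay st1.
have [st0|st_neq0] := eqVneq (`|s| + `|t|) 0.
  have /eqP := st0; rewrite paddr_eq0 // !normr_eq0 => /andP[/eqP-> /eqP->].
  by rewrite scale0r add0r; apply: bA => //; rewrite normr0.
set k := `|s| + `|t| in st1 st_neq0.
have k0 : 0 < k by rewrite lt_def st_neq0 addr_ge0.
have bk (a : R) z : A z -> A ((k * Num.sg a) *: z).
  apply: bA; rewrite normrM normr_sg (ger0_norm (ltW k0)).
  by case: (a != 0); rewrite ?mulr1 ?mulr0.
have sk : 0 <= `|s| / k <= 1.
  by rewrite divr_ge0 ?(ltW k0) //= ler_pdivrMr // mul1r lerDl.
have := (convex_setP A).1 cA _ _ _ sk (bk s x Ax) (bk t y Ay).
rewrite !scalerA; congr (A (_ *: _ + _ *: _)).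
  by rewrite mulrA divfK // mulrC -numEsg.
have -> : 1 - `|s| / k = `|t| / k by rewrite /k; field.
by rewrite mulrA divfK // mulrC -numEsg.
Qed.

Lemma hull_closed A : closed (closed_absconvex_hull A).
Proof. by apply: closed_bigI => B [[]]. Qed.

Lemma hull_absolutely_convex A : absolutely_convex (closed_absconvex_hull A).
Proof.
split=> [|a x a1 Ax B hB]; last first.
  by have [[_ [_ bB]] _] := hB; apply: bB => //; exact: (Ax _ hB).
apply/convex_setP => t x y t01 Ax Ay B hB.
have [[_ [cB _]] _] := hB.
exact: (convex_setP B).1 cB _ _ _ t01 (Ax _ hB) (Ay _ hB).
Qed.

Lemma hull_sub_cball A r : 0 < r -> (forall x, A x -> `|x| <= r) ->
  forall x, closed_absconvex_hull A x -> `|x| <= r.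
Proof.
move=> r0 Ar x Ax.
suff : closed_ball_ Num.norm (0 : X) r x by rewrite /closed_ball_ /= sub0r normrN.
apply: (smallest_sub _ _ Ax); last first.
  by move=> y /Ar; rewrite /closed_ball_ /= sub0r normrN.
split; first by rewrite -closed_ballE //; exact: closed_ball_closed.
split=> [|a y a1]; rewrite /closed_ball_ /= ?sub0r ?normrN.
  apply/convex_setP => t y z /andP[t0 t1]; rewrite /= !sub0r !normrN => yr zr.
  apply: le_trans (ler_normD _ _) _.
  rewrite !normrZ !ger0_norm ?subr_ge0 //.
  have : t * `|y| <= t * r by rewrite ler_wpM2l.
  have : (1 - t) * `|z| <= (1 - t) * r by rewrite ler_wpM2l // subr_ge0.
  lra.
rewrite normrZ => yr; have : `|a| * `|y| <= `|y| by rewrite ler_piMl.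
lra.
Qed.

End Hull.

Lemma diam_le (R : realType) (X : normedModType R) (A : set X) (r : R) :
  0 <= r -> (forall x y, A x -> A y -> `|x - y| <= r) -> diam A <= r.
Proof.
by move=> r0 Ar; apply: sup_le_nonneg => // _ [y Ay [z Az <-]]; exact: Ar.
Qed.

(** * From separating balls to small slices *)

Section BallsSlices.
Variables (R : realType) (X : normedModType R) (F : set (set X)).
Hypothesis hF : compatible_class F.
Implicit Types (A C : set X) (f g : dual X) (x y z u v : X) (e eta delta K : R).

(* [g x > 1 - delta] at [x = z / |z|] makes [g] positive on [A + beta B(X)], and
   [x] is also a direction in which [g] almost attains its norm. *)
Lemma slice_lower_bound A z r beta eta delta g a :
  0 <= beta -> 0 < r -> 0 < eta ->
  enlarge A beta `<=` cball z r -> eta < dist 0 (cball z r) ->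
  0 < delta -> delta * `|z| <= eta ->
  wslice (`|z|^-1 *: z) delta g -> A a -> beta * (1 - delta) <= g a.
Proof.
move=> beta0 r0 eta0 Azr etaz delta0 dz [g1 gx] Aa.
have := lt_dist_cball (ltW eta0) (ltW r0) etaz => zr.
have z0 : 0 < `|z| by lra.
have x1 : `| `|z|^-1 *: z| = 1 by rewrite normrZ normfV normr_id mulVf ?gt_eqF.
set x := `|z|^-1 *: z in gx x1.
have gz : g z = `|z| * g x by rewrite linearZ /= mulVKf ?gt_eqF.
(* As [a - beta x] lies in the ball, [g z - g a + beta g x <= r < |z| - eta]; the loss [delta |z|]
   in [g z] is covered by [eta]. *)
have : cball z r (a - beta *: x).
  rewrite -scalerN; apply: Azr; exists a => //; exists (- x) => //.
  by rewrite /unit_ball /= normrN x1.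
rewrite /cball /closed_ball_ /= => zar.
have := le_trans (dual_ball_le (z - (a - beta *: x)) g1) zar.
rewrite ler_norml !linearB linearZ /= gz => /andP[_].
rewrite /GRing.scale /= => h.
have : `|z| * (1 - delta) <= `|z| * g x by rewrite ler_pM2l // ltW.
have : beta * (1 - delta) <= beta * g x by rewrite ler_wpM2l // ltW.
lra.
Qed.

(* For [u] almost norming [f], let [G] be the hull of [4 C] and [4 u], and [A]
   the part of [G] where [f >= 1 - e].  For [c] in [C] and [s = f c / f u], the
   vector [y = c - s u] lies in [ker f], and [u], [u + y], [u - y] lie in [A].
   Hence a functional [g] of norm at most 1 with [g >= 1 - 3 e] on [A] is small
   at [y] and close to [f] at [u]. *)
Lemma separating_balls_slices e eta K :
  0 < e <= 1 / 2 -> 0 < K -> 0 < eta ->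
  separating_balls F e (1 - 2 * e) 8 eta K ->
  small_slices F (10 * e) (Num.min e (eta / (K + 5))).
Proof.
move=> /andP[e0 e2] K0 eta0 sep C FC C1 f f1.
have [u u1 fu] := dual_sphere_adherent f1 e0.
(* The factor 4 puts [s u + k c] into [G] whenever [|s| <= 3] and [|k| <= 1], which covers [u + y]
   and [u - y]. It also gives diameter at most 8. *)
pose G := closed_absconvex_hull ([set 4 *: y | y in C] `|` [set 4 *: u]).
have FG : F G.
  by apply: (compatible_hull hF); apply: (compatible_setU1 hF); exact: scaled_mem.
have absG : absolutely_convex G by exact: hull_absolutely_convex.
have G4 x : G x -> `|x| <= 4.
  apply: hull_sub_cball => // {}x [[y /C1 y1 <-]|->];
    by rewrite normrZ ger0_norm // ler_piMr.
have GC c : C c -> G (4 *: c).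
  by move=> Cc; apply: sub_gen_smallest; left; exists c.
have Gu : G (4 *: u) by apply: sub_gen_smallest; right.
pose A := G `&` [set x | 1 - e <= f x].
have GA x : G x -> f x = f u -> A x by move=> Gx fx; split=> //=; rewrite fx ltW.
have comb s c : C c -> `|s| <= 3 -> forall k, `|k| <= 1 -> G (s *: u + k *: c).
  move=> Cc s3 k k1.
  have -> : s *: u + k *: c = (s / 4) *: (4 *: u) + (k / 4) *: (4 *: c).
    by rewrite !scalerA !divfK.
  apply: absolutely_convex_comb => //; first exact: GC.
  by rewrite !normrM !(@ger0_norm _ (4^-1)) ?invr_ge0 //; lra.
have Au : A u.
  apply: GA => //; have -> : u = 4^-1 *: (4 *: u) by rewrite scalerA mulVf ?scale1r.
  by apply: absG.2 => //; rewrite ger0_norm ?invr_ge0 // invf_le1 // ler1n.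
have [|||||z [r [/andP[r0 rK] Azr etaz]]] := sep A.
- by apply: (compatible_subset hF FG) => x [].
- apply: closedI; first exact: hull_closed.
  have /continuous_closedP f_closed := @dual_continuous _ _ f.
  exact: (f_closed [set x : R^o | 1 - e <= x] (@closed_ge _ _)).
- apply/convex_setP => t x y t01 [Gx fx] [Gy fy]; split.
    exact: (convex_setP G).1 absG.1 t x y t01 Gx Gy.
  move: t01 => /andP[t0 t1] /=; rewrite linearD !linearZ /= /GRing.scale /=.
  have : t * (1 - e) <= t * f x by rewrite ler_wpM2l.
  have : (1 - t) * (1 - e) <= (1 - t) * f y by rewrite ler_wpM2l // subr_ge0.
  lra.
- apply: diam_le => // x y [/G4 x4 _] [/G4 y4 _].
  by apply: le_trans (ler_normB _ _) _; lra.
(* On the enlargement of [A], [f] is at least [(1 - e) - (1 - 2 e) = e]. *)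
- apply: dist_ge => [|_ [a [Ga fa] [v v1 <-]]].
    by exists (u + (1 - 2 * e) *: u), u => //; exists u.
  have := dual_ball_le (a + (1 - 2 * e) *: v) (dual_sphere_ball f1).
  rewrite linearD [f (_ *: v)]linearZ ler_norml => /andP[_].
  have := le_trans (dual_ball_le v (dual_sphere_ball f1)) v1.
  rewrite ler_norml => /andP[fv _].
  have : (1 - 2 * e) * -1 <= (1 - 2 * e) * f v by rewrite ler_wpM2l //; lra.
  by move: fa; rewrite /= /GRing.scale /=; lra.
have zr := lt_dist_cball (ltW eta0) (ltW r0) etaz.
have z0 : 0 < `|z| by lra.
set delta := Num.min _ _.
have delta0 : 0 < delta by rewrite lt_min e0 divr_gt0 //; lra.
have delta_e : delta <= e by rewrite ge_min lexx.
have delta_z : delta * `|z| <= eta.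
  have zK : `|z| <= K + 5.
    have beta0 : 0 <= 1 - 2 * e by lra.
    have : cball z r u by apply: Azr; exists u => //; exists 0;
      rewrite ?scaler0 ?addr0 // /unit_ball /= normr0.
    rewrite /cball /closed_ball_ /= => zu.
    by have := ler_normD (z - u) u; rewrite subrK; lra.
  apply: (@le_trans _ _ (eta / (K + 5) * (K + 5))).
    by rewrite ler_pM ?(ltW delta0) // /delta ge_min lexx orbT.
  by rewrite divfK // gt_eqF //; lra.
exists (`|z|^-1 *: z).
  by rewrite /unit_sphere /= normrZ normfV normr_id mulVf ?gt_eqF.
move=> g gz.
(* [(1 - 2 e) (1 - delta) >= 1 - 2 e - delta], and [delta <= e]. *)
have gA a : A a -> 1 - 3 * e <= g a.
  move=> Aa; have beta0 : 0 <= 1 - 2 * e by lra.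
  have := slice_lower_bound beta0 r0 eta0 Azr etaz delta0 delta_z gz Aa.
  apply: le_trans.
  have : (1 - 2 * e) * delta <= 1 * delta by rewrite ler_wpM2r ?ltW //; lra.
  lra.
have [g1 _] := gz.
have gu1 : g u <= 1.
  by apply: le_trans (ler_norm _) (le_trans (dual_ball_le u g1) u1).
have fu1 : f u <= 1.
  exact: le_trans (ler_norm _)
    (le_trans (dual_ball_le u (dual_sphere_ball f1)) u1).
have gu := gA u Au.
apply: (@le_lt_trans _ _ (9 * e)); last by lra.
apply: norm_on_le => [|c Cc]; first by lra.
have fu0 : 0 < f u by lra.
have [s fc s2] : exists2 s, f c = s * f u & `|s| <= 2.
  exists (f c / f u); first by rewrite divfK // gt_eqF.
  rewrite normrM normfV (gtr0_norm fu0) ler_pdivrMr //.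
  have := le_trans (dual_ball_le c (dual_sphere_ball f1)) (C1 c Cc); lra.
have /andP[sl sr] : - 2 <= s <= 2 by rewrite -ler_norml.
have : A ((1 - s) *: u + 1 *: c).
  apply: GA; first by apply: comb; rewrite // ?normr1 // ler_norml; lra.
  by rewrite linearD !linearZ /= fc /GRing.scale /=; lra.
have : A ((1 + s) *: u + (-1) *: c).
  apply: GA; first by apply: comb; rewrite // ?normrN1 // ler_norml; lra.
  by rewrite linearD !linearZ /= fc /GRing.scale /=; lra.
move=> /gA gm /gA gp; move: gm gp.
rewrite !linearD !linearZ /= /GRing.scale /= => gm gp.
(* With [y = c - s u], [f c - g c = s (f u - g u) - g y]; the terms are at most [6 e] and [3 e], the
   latter from [g (u + y)] and [g (u - y)] being at least [1 - 3 e] while [g u <= 1]. *)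
have fgu : `|f u - g u| <= 3 * e by rewrite ler_norml; lra.
have : `|s * (f u - g u)| <= 2 * (3 * e) by rewrite normrM ler_pM.
rewrite !ler_norml fc => /andP[h1 h2]; apply/andP; split; lra.
Qed.

End BallsSlices.

(** * The cycle of implications *)

Theorem theorem4p2 (R : realType) (X : completeNormedModType R)
    (F : set (set X)) (hF : compatible_class F) :
  [<->
  (* (a) *)
  forall eps beta M eta : R,
    0 < eps -> 0 <= beta -> 2 <= M -> 0 < eta < eps ->
    exists2 K : R, 0 < K &
      forall C : set X, F C -> closed C -> convex_set C ->
        diam C <= M -> eps <= dist 0 (enlarge C beta) ->
        exists (z0 : X) (r : R),
          [/\ 0 < r <= K, enlarge C beta `<=` cball z0 r
            & eta < dist 0 (cball z0 r)];
  (* (b) *)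
  forall eps M eta : R,
    0 < eps -> 2 <= M -> 0 < eta < eps ->
    exists2 K : R, 0 < K &
      forall C : set X, F C -> closed C -> convex_set C ->
        diam C <= M -> eps <= dist 0 C ->
        exists (z0 : X) (r : R),
          [/\ 0 < r <= K, C `<=` cball z0 r & eta < dist 0 (cball z0 r)];
  (* (c) *)
  forall eps beta M : R,
    0 < eps -> 0 <= beta -> 2 <= M ->
    exists K eta : R,
      [/\ 0 < K, 0 < eta < eps &
        forall C : set X, F C -> closed C -> convex_set C ->
          diam C <= M -> eps <= dist 0 (enlarge C beta) ->
          exists (z0 : X) (r : R),
            [/\ 0 < r <= K, enlarge C beta `<=` cball z0 r
              & eta < dist 0 (cball z0 r)]];
  (* (d) *)
  forall eps : R, 0 < eps ->
    exists2 delta : R, 0 < delta < 1 &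
      forall C : set X, F C -> C `<=` unit_ball X ->
        forall f : dual X, dual_sphere X f ->
          exists2 x : X, unit_sphere X x &
            wslice x delta `<=` seminorm_ball C f eps;
  (* (e) *)
  forall eps : R, 0 < eps ->
    exists2 delta : R, 0 < delta &
      forall C : set X, F C -> C `<=` unit_ball X ->
        forall f : dual X, dual_sphere X f ->
          exists2 x : X, unit_sphere X x &
            support_functionals_on (unit_sphere X `&` ball x delta)
              `<=` seminorm_ball C f eps;
  (* (f) *)
  forall eps : R, 0 < eps ->
    exists2 delta : R, 0 < delta &
      forall C : set X, F C -> C `<=` unit_ball X ->
        forall f : dual X, dual_sphere X f ->
          exists2 x : X, M_set eps delta C x &
            support_functionals x `<=` seminorm_ball C f eps].
Proof.
tfae.
- move=> a eps M eta eps0 M2 eta_eps.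
  have [K K0 sep] := a eps 0 M eta eps0 (lexx 0) M2 eta_eps.
  by exists K => // C; have := sep C; rewrite enlarge0.
- move=> b eps beta M eps0 beta0 M2.
  (* The shift by [beta] reduces to an unenlarged set; [eps / 2] is the resulting [eta]. *)
  have [||K K0 sep] := b (eps + beta) M (eps / 2 + beta) _ M2; [lra|lra|].
  exists (K + beta), (eps / 2); split; [lra|lra|].
  apply: separating_balls_enlarge => //; first lra.
  by move=> C; have := sep C; rewrite enlarge0.
- move=> c eps eps0.
  (* The slices obtained have tolerance [10 * e], and [e <= 1 / 2] keeps the enlargement [1 - 2 * e]
     nonnegative. *)
  pose e := Num.min (eps / 10) (1 / 2).
  have e0 : 0 < e by rewrite lt_min; lra.
  have e2 : e <= 1 / 2 by rewrite ge_min lexx orbT.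
  have e10 : 10 * e <= eps.
    have : e <= eps / 10 by rewrite ge_min lexx.
    lra.
  have [||K [eta [K0 /andP[eta0 _] sep]]] := c e (1 - 2 * e) 8 e0; [lra|lra|].
  exists (Num.min e (eta / (K + 5))).
    by rewrite lt_min e0 divr_gt0 /= ?gt_min; lra.
  have e02 : 0 < e <= 1 / 2 by rewrite e0.
  move=> C FC C1 f f1.
  have [x x1 xsl] := separating_balls_slices hF e02 K0 eta0 sep FC C1 f1.
  by exists x => // g /xsl; move=> /lt_le_trans; apply.
- move=> d eps eps0; have [delta /andP[delta0 _] sl] := d eps eps0.
  by exists delta => //; exact: small_slices_supports.
- move=> e eps eps0; have [|delta delta0 ss] := e (eps / 4); first lra.
  exists (Num.min (delta / 2) (1 / 2)); first by rewrite lt_min; lra.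
  exact: small_supports_smooth.
- move=> f eps beta M eta eps0 beta0 M2 /andP[eta0 eta_eps].
  have etab : 0 < eta + beta < eps + beta by lra.
  (* The slice tolerance needed to build balls for the unenlarged problem at levels [eps + beta] and
     [eta + beta]; (f) reaches (a) through slices. *)
  set e := (eps + beta - (eta + beta)) / 2 / (M + (eps + beta)).
  have e0 : 0 < e by rewrite /e !divr_gt0 //; lra.
  have [|delta delta0 ss] := f (e / 4); first lra.
  have sl := smooth_supports_slices e0 delta0 ss.
  have [|K K0 sep] := small_slices_balls hF etab M2 _ sl.
    apply/andP; split; last by rewrite gt_min; apply/orP; right; lra.
    by rewrite lt_min mulr_gt0 ?divr_gt0 //; lra.
  by exists (K + beta); [lra|exact: separating_balls_enlarge].
Qed.
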